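(* Let $(a_n)_{n\ge1}$ be a strictly increasing sequence of positive integers such that $a_{n+1}-a_n\le d$ for all $n\in\mathbb N$, for some fixed natural number $d\ge2$, and let $V=\mathbb N\setminus\{a_1,a_2,\dots\}$ (assumed nonempty). Then the set $C[\bar O^1,V]$ has Lebesgue measure $0$.
   Context: Every irrational $x\in(0,1)$ has a unique expansion $x=\sum_{n\ge1}\frac{(-1)^{n-1}}{g_1(g_1+g_2)\cdots(g_1+\dots+g_n)}$ with all $g_n\in\mathbb N$; $g_n=g_n(x)$ is the $n$-th $\bar O^1$-symbol of $x$. For $V\subset\mathbb N$ nonempty, $C[\bar O^1,V]$ denotes the closure in $[0,1]$ of the set of irrational $x\in(0,1)$ with $g_k(x)\in V$ for all $k\in\mathbb N$. *)

(* Defs.v *)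
From HB Require Import structures.
From mathcomp Require Import all_boot all_order all_algebra.
From mathcomp Require Import all_classical all_reals all_analysis.

Set Implicit Arguments.
Unset Strict Implicit.
Unset Printing Implicit Defensive.

Import Order.TTheory GRing.Theory Num.Theory.
Import numFieldNormedType.Exports.

Local Open Scope classical_set_scope.
Local Open Scope ring_scope.

(* Indices start at 0: [g n] is the symbol g_{n+1}, and [O1_term R g n] is
   (-1)^n / (g_1 (g_1 + g_2) ... (g_1 + ... + g_{n+1})). *)
Definition O1_term (R : realType) (g : nat -> nat) (n : nat) : R :=
  (-1) ^+ n / \prod_(i < n.+1) (\sum_(j < i.+1) g j)%N%:R.

Definition O1_symbols (R : realType) (x : R) (g : nat -> nat) : Prop :=
  (forall n, (0 < g n)%N) /\ series (O1_term R g) @ \oo --> x.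

(* An irrational x in (0, 1) has exactly one sequence of symbols, so the
   existential below only names it. *)
Definition O1_set (R : realType) (V : set nat) : set R :=
  [set x : R | [/\ 0 < x, x < 1, irrational x &
     exists2 g : nat -> nat, O1_symbols x g & forall k, V (g k)]].

(* The closure in the subspace [0, 1] is the trace of the closure in R. *)
Definition C_O1 (R : realType) (V : set nat) : set R :=
  closure (@O1_set R V) `&` `[0, 1].

(* Main.v *)
(** Write the expansions with an offset q: E_q is the set of sums
    1/(q+g_1) - 1/((q+g_1)(q+g_1+g_2)) + ... with all g_k in V, so E_q lies in
    [0, 1/(q+1)] and is the union over v in V of the images of E_(q+v) under
    x |-> (1-x)/(q+v). Away from 0 this union is locally finite, so the closures
    satisfy the same inclusion up to the point 0. Let |E_q| be the measure of the
    closure of E_q. If |E_p| <= C/(p+1) for all p, then |E_q| <= C * sum_(v in V) 1/((q+v)(q+v+1)). Over all v >= 1 this sum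
    telescopes to 1/(q+1), and since the complement of V has gaps at most d, it
    carries a fraction at least 1/(d a_1) of the total. Hence
    |E_q| <= (1 - 1/(d a_1))^n / (q+1) for every n. *)

Require Import Defs.
From mathcomp Require Import all_boot all_order all_algebra.
From mathcomp Require Import all_classical all_reals all_analysis.
From mathcomp Require Import ring lra.
Import Order.TTheory GRing.Theory Num.Theory.
Import numFieldNormedType.Exports.
Local Open Scope classical_set_scope.
Local Open Scope ring_scope.

(** * Partial sums of the expansion with an offset *)

Fixpoint psum (R : realType) (q : nat) (g : nat -> nat) (n : nat) : R :=
  if n is m.+1 then (1 - psum R (q + g 0)%N (g \o S) m) / (q + g 0)%N%:R else 0.

(** [psum] moves the first symbol into the offset, so the map x |-> (1-x)/(q+v) is built into it;
    unfolding from the front yields the alternating sum, which for q = 0 is a partial sum of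
    [O1_term]. *)
Lemma psumE (R : realType) (q : nat) (g : nat -> nat) (n : nat) :
  psum R q g n =
  \sum_(k < n) (-1) ^+ k / \prod_(i < k.+1) (q + \sum_(j < i.+1) g j)%N%:R.
Proof.
elim: n q g => [|n IHn] q g /=; first by rewrite big_ord0.
rewrite IHn big_ord_recl /= big_ord1 big_ord1 expr0 mulrBl; congr (_ + _).
rewrite -mulNr -sumrN mulr_suml; apply: eq_bigr => k _.
rewrite [in RHS]big_ord_recl /= big_ord1 invfM exprS mulN1r !mulNr mulrA.
rewrite mulrAC; congr (- (_ / _ / _)); apply: eq_bigr => i _.
by rewrite [in RHS]big_ord_recl /= addnA.
Qed.

(** Induction with q free: a tail s in [0, 1] is sent by s |-> (1-s)/p into [0, 1/p], and p = q +
    g_1 is at least q + 1. *)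
Lemma psum_itv (R : realType) (q : nat) (g : nat -> nat) (n : nat) :
  (forall k, (0 < g k)%N) -> 0 <= psum R q g n <= q.+1%:R^-1.
Proof.
elim: n q g => [|n IHn] q g g_gt0 /=; first by rewrite lexx invr_ge0 ler0n.
have /andP[] := IHn (q + g 0)%N (g \o S) (fun k => g_gt0 k.+1).
move: (psum _ _ _ _) => s s_ge0 s_le.
have p_gt0 : 0 < (q + g 0)%N%:R :> R by rewrite ltr0n addn_gt0 g_gt0 orbT.
have s_le1 : s <= 1 by apply: le_trans s_le _; rewrite invf_le1 ?ler1n ?ltr0n.
rewrite divr_ge0 ?subr_ge0 ?(ltW p_gt0)//=.
apply: (@le_trans _ _ (q + g 0)%N%:R^-1).
  by rewrite ler_pdivrMr// mulVf ?gt_eqF// gerBl.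
by rewrite lef_pV2 ?posrE// ler_nat -addn1 leq_add2l.
Qed.

(** * The sets E_q, their closures, and removal of the first symbol *)

Definition O1q_set (R : realType) (V : set nat) (q : nat) : set R :=
  [set x | exists2 g : nat -> nat, psum R q g @ \oo --> x & forall k, V (g k)].

Section offset.
Variables (R : realType) (V : set nat).
Hypothesis V_gt0 : forall v, V v -> (0 < v)%N.

Lemma O1_set_sub : O1_set V `<=` O1q_set R V 0.
Proof.
move=> x [_ _ _ [g [g_gt0 gx] gV]]; exists g => //.
suff -> : psum R 0 g = series (O1_term R g) by [].
apply/funext => n; rewrite psumE /series /= big_mkord.
by apply: eq_bigr => k _; congr (_ / _); apply: eq_bigr.
Qed.

Lemma O1q_set_itv q : O1q_set R V q `<=` `[0, q.+1%:R^-1].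
Proof.
move=> x [g gx gV]; apply: closed_cvg gx; first exact: itv_closed.
apply: nearW => n /=; rewrite in_itv /=.
by apply: psum_itv => k; exact: V_gt0.
Qed.

Lemma closure_O1q_set_itv q : closure (O1q_set R V q) `<=` `[0, q.+1%:R^-1].
Proof.
by rewrite closureE; apply: smallest_sub; [exact: itv_closed|exact: O1q_set_itv].
Qed.

Lemma O1q_set_step q x : O1q_set R V q x ->
  exists2 v, V v & O1q_set R V (q + v)%N (1 - (q + v)%N%:R * x).
Proof.
move=> [g gx gV]; exists (g 0) => //; exists (g \o S); last by move=> k; exact: gV.
have p_neq0 : (q + g 0)%N%:R != 0 :> R.
  by rewrite pnatr_eq0 -lt0n addn_gt0 (V_gt0 _ (gV 0)) orbT.
have -> : psum R (q + g 0)%N (g \o S) =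
    fun n => 1 - (q + g 0)%N%:R * psum R q g (n + 1)%N.
  by apply/funext => n; rewrite addn1 /= mulrC divfK// subKr.
apply: cvgB; first exact: cvg_cst.
apply: cvgM; first exact: cvg_cst.
by move: gx; rewrite -(cvg_shiftn 1).
Qed.

Lemma closure_O1q_set_step q x : closure (O1q_set R V q) x -> x = 0 \/
  exists2 v, V v & closure (O1q_set R V (q + v)%N) (1 - (q + v)%N%:R * x).
Proof.
move=> qx; have := closure_O1q_set_itv _ _ qx.
rewrite /= in_itv /= le_eqVlt => /andP[/orP[/eqP <-|x_gt0] _]; first by left.
(* Points with first symbol v are at most 1/(q+v), hence at most x/2 once v >= N. So E_q lies in the
   union of finitely many closed pieces and a closed half-line that misses x. *)
right; pose N := Num.bound (2 / x).
have N_gt : 2 / x < N%:R by apply: archi_boundP; rewrite divr_ge0// ltW.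
pose D := V `&` `I_N.
pose F v := (fun y : R => 1 - (q + v)%N%:R * y) @^-1`
  closure (O1q_set R V (q + v)%N).
have closedF v : closed (F v).
  apply: preimage_closed; last exact: closed_closure.
  move=> y _; apply: cvgB; first exact: cvg_cst.
  by apply: cvgM; [exact: cvg_cst|exact: cvg_id].
have closedD : closed ((\bigcup_(v in D) F v) `|` [set y : R | y <= x / 2]).
  apply: closedU; last exact: closed_le.
  apply: closed_bigcup => //.
  by apply: sub_finite_set (finite_II N) => v [].
have sub : O1q_set R V q `<=` (\bigcup_(v in D) F v) `|` [set y : R | y <= x / 2].
  move=> y /O1q_set_step [v Vv qvy].
  have [vN|Nv] := ltnP v N.
    by left; exists v => //; exact: subset_closure.
  right; have := O1q_set_itv _ _ qvy; rewrite /= in_itv /= => /andP[+ _].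
  rewrite subr_ge0 => le1; rewrite leNgt; apply/negP => lty.
  have : 2 / x * (x / 2) < (q + v)%N%:R * y.
    apply: ltr_pM => //; rewrite ?divr_ge0// ?(ltW x_gt0)//.
    by apply: lt_le_trans N_gt _; rewrite ler_nat (leq_trans Nv)// leq_addl.
  by rewrite mulrA divfK ?gt_eqF// mulfV// ltNge le1.
move: qx; rewrite closureE => /(smallest_sub closedD sub).
case=> [[v [Vv _]] Fv|/= xx]; first by exists v.
by exfalso; lra.
Qed.

(** * Measure of affine preimages and its decay by a factor [r] per symbol *)

Lemma lebesgue_measure_affine_preimage (al be l : R) : be != 0 -> 0 <= l ->
  lebesgue_measure ((fun y => al + be * y) @^-1` `[0, l]) = (l / `|be|)%:E.
Proof.
move=> be0 l0.
have -> : (fun y => al + be * y) @^-1` `[0, l] =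
    [set` if 0 < be then `[- al / be, (l - al) / be]
          else `[(l - al) / be, - al / be]].
  apply/seteqP; split => y /=; case: ltP => be_sgn; rewrite /= !in_itv /=.
  - rewrite ler_pdivrMr// ler_pdivlMr//; lra.
  - rewrite ler_ndivrMr ?ler_ndivlMr ?lt_neqAle ?be0//; lra.
  - rewrite ler_pdivrMr// ler_pdivlMr//; lra.
  - rewrite ler_ndivrMr ?ler_ndivlMr ?lt_neqAle ?be0//; lra.
(* The interval formula returns 0 unless the left end is strictly below the right one; that
   degenerate case forces l = 0. *)
case: ltP => be_sgn; rewrite lebesgue_measure_itv /= lte_fin.
- rewrite gtr0_norm// ltr_pM2r ?invr_gt0//; case: ltP => h; first by
    rewrite -EFinB; congr _%:E; ring.
  have -> : l = 0 by lra.
  by rewrite mul0r.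
- have be_lt0 : be < 0 by rewrite lt_neqAle be0.
  rewrite ltr0_norm// ltr_nM2r ?invr_lt0//; case: ltP => h; first by
    rewrite -EFinB; congr _%:E; rewrite invrN; ring.
  have -> : l = 0 by lra.
  by rewrite mul0r.
Qed.

(** Contraction factor 1/(q+v) of the piece with first symbol v, times the length bound 1/(q+v+1)
    for E_(q+v). The value 0 off [V] lets sums run over integer intervals. *)
Definition weight (q v : nat) : R :=
  if `[< V v >] then ((q + v)%:R * (q + v).+1%:R)^-1 else 0.

Lemma weight_ge0 q v : 0 <= weight q v.
Proof. by rewrite /weight; case: ifP => // _; rewrite invr_ge0 mulr_ge0. Qed.

Section shrink.
Variable r : R.
Hypothesis r_ge0 : 0 <= r.
Hypothesis sum_weight : forall q N, \sum_(0 <= v < N) weight q v <= r / q.+1%:R.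

(* Quantifying over affine preimages makes the induction go through without
   scaling measures: an affine map composes with [1 - (q + v) * _]. *)
Lemma measure_closure_O1q_set n q (al be : R) : be != 0 ->
  (lebesgue_measure
      ((fun y => al + be * y)%R @^-1` closure (O1q_set R V q)) <=
    (r ^+ n / (q.+1%:R * `|be|))%:E)%E.
Proof.
have closedP q' (u v : R) :
    closed ((fun y : R => u + v * y) @^-1` closure (O1q_set R V q')).
  apply: preimage_closed; last exact: closed_closure.
  move=> y _; apply: cvgD; first exact: cvg_cst.
  by apply: cvgM; [exact: cvg_cst|exact: cvg_id].
elim: n q al be => [|n IHn] q al be be0.
  rewrite expr0 mul1r invfM -(lebesgue_measure_affine_preimage al) ?invr_ge0//.
  apply: le_measure; rewrite ?inE.
  - by apply: measurable_realfun.closed_measurable; exact: closedP.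
  - apply: measurable_realfun.closed_measurable.
    apply: preimage_closed; last exact: itv_closed.
    move=> y _; apply: cvgD; first exact: cvg_cst.
    by apply: cvgM; [exact: cvg_cst|exact: cvg_id].
  - by apply: preimage_subset; exact: closure_O1q_set_itv.
(* The index 0, which is not in [V], carries the exceptional point. *)
pose F v : set R := if v == 0%N then [set - al / be] else
  if `[< V v >] then (fun y => (1 - (q + v)%:R * al) + (- (q + v)%:R * be) * y)
    @^-1` closure (O1q_set R V (q + v)%N) else set0.
have mF v : measurable (F v).
  rewrite /F; case: ifP => _; first exact: measurable_set1.
  case: ifP => _ //.
  by apply: measurable_realfun.closed_measurable; exact: closedP.
have mA := measurable_realfun.closed_measurable (closedP q al be).
have /le_trans : (lebesgue_measure
      ((fun y => al + be * y)%R @^-1` closure (O1q_set R V q)) <=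
    \sum_(0 <= v <oo) lebesgue_measure (F v))%E.
  apply: measure_sigma_subadditive => //.
  move=> y /= /closure_O1q_set_step[z0|[v Vv qv]].
    exists 0%N => //; rewrite /F eqxx /=; apply: (mulfI be0).
    by rewrite mulrCA mulfV// mulr1; lra.
  exists v => //; rewrite /F gtn_eqF ?V_gt0//.
  move/asboolP: (Vv) => -> /=; congr (closure _ _) : qv; ring.
apply.
(* The composed affine map has slope -(q+v) [be], so the induction hypothesis at offset q+v produces
   exactly the weight; the singleton at index 0 has measure 0. *)
have leF v : (lebesgue_measure (F v) <= (r ^+ n / `|be| * weight q v)%:E)%E.
  rewrite /F /weight; case: eqP => [->|/eqP v0].
    rewrite lebesgue_measure_set1 lee_fin mulr_ge0 ?divr_ge0 ?exprn_ge0//.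
    exact: (weight_ge0 q 0).
  case: ifP => _; last by rewrite measure0 mulr0.
  have qv0 : (q + v)%:R != 0 :> R by rewrite pnatr_eq0 addn_eq0 negb_and v0 orbT.
  apply: le_trans (IHn _ _ _ _) _; first by rewrite mulf_neq0// oppr_eq0.
  rewrite lee_fin normrM normrN normr_nat le_eqVlt; apply/orP; left; apply/eqP.
  by rewrite !invfM; ring.
(* Every partial sum obeys the bound, with [sum_weight] supplying the next factor [r]; hence so does
   the series. *)
apply: lime_le; first by apply: is_cvg_nneseries => v _ _; exact: measure_ge0.
apply: nearW => N.
apply: le_trans (_ : _ <= \sum_(0 <= v < N) (r ^+ n / `|be| * weight q v)%:E)%E _.
  by apply: lee_sum => v _; exact: leF.
rewrite sumEFin lee_fin -mulr_sumr exprSr -mulrA [_ * `|be|]mulrC invfM.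
rewrite -mulrA ler_wpM2l ?exprn_ge0// [r * _]mulrCA ler_wpM2l ?invr_ge0//.
Qed.

Lemma measure_closure_O1q_set_eq0 : r < 1 ->
  lebesgue_measure (closure (O1q_set R V 0)) = 0%E.
Proof.
move=> r_lt1; apply/eqP; rewrite eq_le measure_ge0 andbT.
have H n : (lebesgue_measure (closure (O1q_set R V 0)) <= (r ^+ n)%:E)%E.
  have := @measure_closure_O1q_set n 0 0 1 (oner_neq0 _).
  rewrite normr1 mulr1 divr1; congr (lebesgue_measure _ <= _)%E.
  by apply/seteqP; split => y /=; rewrite add0r mul1r.
have mu_fin : lebesgue_measure (closure (O1q_set R V 0)) \is a fin_num.
  by rewrite ge0_fin_numE ?measure_ge0// (le_lt_trans (H 0%N))// ltry.
rewrite -(fineK mu_fin) lee_fin.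
apply: (cvgr_to_ge (@cvg_expr _ r _)); first by rewrite ger0_norm.
by apply: nearW => n; rewrite -lee_fin fineK.
Qed.

End shrink.

(** * The gap condition yields a ratio below 1 *)

Section gaps.
Variables (a : nat -> nat) (d : nat).
Hypothesis a_gt0 : forall n, (0 < a n)%N.
Hypothesis a_incr : forall n, (a n < a n.+1)%N.
Hypothesis d_gt0 : (0 < d)%N.
Hypothesis a_gap : forall n, (a n.+1 - a n <= d)%N.
Hypothesis V_a : forall n, ~ V (a n).

(** Telescoping: each weight is at most 1/(q+v) - 1/(q+v+1). *)
Lemma sum_weight_le q m n : (0 < m)%N -> (m <= n)%N ->
  \sum_(m <= v < n) weight q v <= (q + m)%:R^-1 - (q + n)%:R^-1.
Proof.
move=> m0; elim: n => [|n IHn]; first by rewrite leqNgt m0.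
rewrite leq_eqVlt => /orP[/eqP <-|mn]; first by rewrite big_geq// subrr.
rewrite big_nat_recr//=.
have qn0 : 0 < (q + n)%:R :> R by rewrite ltr0n addn_gt0 (leq_trans m0 mn) orbT.
have : weight q n <= (q + n)%:R^-1 - (q + n.+1)%:R^-1.
  have -> : (q + n)%:R^-1 - (q + n.+1)%:R^-1 =
      ((q + n)%:R * (q + n).+1%:R)^-1 :> R.
    rewrite addnS -natr1; field; lra.
  by rewrite /weight; case: ifP => // _; rewrite invr_ge0 mulr_ge0.
have := IHn mn; lra.
Qed.

(** With y = q + [a n] and z = q + [a n.+1], the missing index [a n] costs 1/(y(y+1)). This is at
    least 1/d of the full block (z-y)/(yz), because z-y <= d and y+1 <= z. *)
Lemma sum_weight_gap q n : \sum_(a n <= v < a n.+1) weight q v <=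
  (1 - d%:R^-1) * ((q + a n)%:R^-1 - (q + a n.+1)%:R^-1).
Proof.
rewrite big_ltn// {1}/weight; case: asboolP => [/V_a//|_]; rewrite add0r.
have := sum_weight_le q _ _ (ltn0Sn _) (a_incr n).
move=> /le_trans; apply.
have y0 : 0 < (q + a n)%:R :> R by rewrite ltr0n addn_gt0 a_gt0 orbT.
have yz : (q + a n)%:R + 1 <= (q + a n.+1)%:R :> R.
  by rewrite natr1 ler_nat -addnS leq_add2l.
have zy : (q + a n.+1)%:R <= (q + a n)%:R + d%:R :> R.
  by rewrite -natrD ler_nat -addnA leq_add2l -leq_subLR.
have d0 : 0 < d%:R :> R by rewrite ltr0n.
rewrite addnS -natr1.
move: (q + a n)%:R (q + a n.+1)%:R y0 yz zy => y z y0 yz zy.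
rewrite -subr_ge0.
have -> : (1 - d%:R^-1) * (y^-1 - z^-1) - ((y + 1)^-1 - z^-1) =
  (d%:R * z - (z - y) * (y + 1)) / (d%:R * z * y * (y + 1)).
  by field; apply/and4P; split; apply: lt0r_neq0; lra.
rewrite divr_ge0 ?mulr_ge0 ?subr_ge0; try lra.
by apply: ler_pM; lra.
Qed.

Lemma sum_weight_a q n : \sum_(0 <= v < a n) weight q v <=
  q.+1%:R^-1 - (q + a 0)%:R^-1 +
  (1 - d%:R^-1) * ((q + a 0)%:R^-1 - (q + a n)%:R^-1).
Proof.
elim: n => [|n IHn].
  (* Index 0 is not in [V], so the telescoping starts at 1; before [a 0] no loss is claimed. *)
  rewrite subrr mulr0 addr0 big_ltn// {1}/weight; case: asboolP => [/V_gt0//|_].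
  by rewrite add0r -[X in X%:R^-1 - _]addn1; apply: sum_weight_le.
rewrite (big_cat_nat (n := a n))//=; last exact: ltnW.
apply: le_trans (lerD IHn (sum_weight_gap q n)) _.
by rewrite -addrA -mulrDr addrA subrK.
Qed.

(** The blocks add up to at most 1/(q+1) - (1/d)/(q + [a 0]), and q + [a 0] <= [a 0] (q+1) makes the
    loss proportional to 1/(q+1) uniformly in q. *)
Lemma sum_weight_bound q N :
  \sum_(0 <= v < N) weight q v <= (1 - (d * a 0)%:R^-1) / q.+1%:R.
Proof.
(* Extending the sum up to [a N] makes it end at a block boundary. *)
have aN : (N <= a N)%N by elim: N => // n IHn; exact: leq_ltn_trans (a_incr n).
apply: (@le_trans _ _ (\sum_(0 <= v < a N) weight q v)).
  rewrite [leRHS](big_cat_nat (n := N))//= lerDl.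
  by apply: sumr_ge0 => v _; exact: weight_ge0.
apply: le_trans (sum_weight_a q N) _.
have d1 : 0 <= 1 - d%:R^-1 :> R by rewrite subr_ge0 invf_le1 ?ler1n ?ltr0n.
have i0 : 0 <= (q + a N)%:R^-1 :> R by rewrite invr_ge0.
have : (1 - d%:R^-1) * ((q + a 0)%:R^-1 - (q + a N)%:R^-1) <=
    (1 - d%:R^-1) * (q + a 0)%:R^-1 :> R.
  by rewrite ler_wpM2l// gerBl.
have : (d * a 0)%:R^-1 / q.+1%:R <= d%:R^-1 * (q + a 0)%:R^-1 :> R.
  rewrite -!invfM lef_pV2 ?posrE -?natrM ?ltr0n ?muln_gt0 ?addn_gt0
    ?d_gt0 ?a_gt0 ?orbT//.
  by rewrite ler_nat -mulnA leq_mul2l mulnS addnC leq_add2l leq_pmull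
    ?a_gt0 ?orbT.
by move: d%:R^-1 (q + a 0)%:R^-1 (q + a N)%:R^-1 (d * a 0)%:R^-1
  q.+1%:R^-1 => *; nra.
Qed.

End gaps.
End offset.

Theorem theorem8 (R : realType) (a : nat -> nat) (d : nat) (V : set nat)
    (a_gt0 : forall n, (0 < a n)%N)
    (a_incr : forall n, (a n < a n.+1)%N)
    (d_ge2 : (2 <= d)%N)
    (a_gap : forall n, (a n.+1 - a n <= d)%N)
    (V_def : V = [set v : nat | (0 < v)%N] `\` range a)
    (V_neq0 : V !=set0) :
  lebesgue_measure (@C_O1 R V) = 0%E.
Proof.
have V_gt0 v : V v -> (0 < v)%N by rewrite V_def => -[].
have V_a n : ~ V (a n) by rewrite V_def => -[_]; apply; exists n.
have d_gt0 : (0 < d)%N by exact: ltnW.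
have da_gt0 : (0 < d * a 0)%N by rewrite muln_gt0 d_gt0 a_gt0.
have K0 : lebesgue_measure (closure (O1q_set R V 0)) = 0%E.
  apply: (@measure_closure_O1q_set_eq0 _ _ V_gt0 (1 - (d * a 0)%:R^-1)).
  - by rewrite subr_ge0 invf_le1 ?ler1n ?ltr0n.
  - exact: sum_weight_bound.
  - by rewrite gtrBl invr_gt0 ltr0n.
(* The set is contained in the null closure of E_0, so monotonicity concludes. *)
apply/eqP; rewrite eq_le measure_ge0 andbT -K0.
apply: le_measure; rewrite ?inE.
- apply: measurableI; last exact: measurable_itv.
  apply: measurable_realfun.closed_measurable; exact: closed_closure.
- apply: measurable_realfun.closed_measurable; exact: closed_closure.
- by move=> x [Vx _]; apply: closureS Vx; exact: O1_set_sub.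
Qed.
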